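(* Let $m$ be a nonzero integer and let $f:\mathbb{N}\to\mathbb{Z}_m$ be a continuous map which is unbounded on each congruence class, i.e. for all integers $a,b$ with $b>0$ the set $\{f(n) : n\in\mathbb{N},\ n\equiv a \pmod b\}$ is unbounded. If $f(n)$ is prime to $m$ for each $n\in\mathbb{N}$, then the sequence $\{f(n)\}_{n=1}^{\infty}$ has infinitely many prime divisors.
   Context: $\mathbb{N}$ denotes the set of positive integers. For $a,b\in\mathbb{Z}$ with $b>0$, let $Con(a,b)=\{x\in\mathbb{Z} : x\equiv a \pmod b\}$. The Furstenberg topology $\mathcal{F}$ on $\mathbb{Z}$ is the topology having all the classes $Con(a,b)$ ($a,b\in\mathbb{Z}$, $b>0$) as a basis of open sets; $\mathbb{N}$ carries the subspace topology induced by $\mathcal{F}$. For a nonzero integer $m$, $\mathcal{F}_m$ is the topology on $\mathbb{Z}$ having as a basis of open sets the classes $Con(a,b)$ with $a\in\mathbb{Z}$ and $b$ a positive integer prime to $m$; the symbol $\mathbb{Z}_m$ denotes the topological space $(\mathbb{Z},\mathcal{F}_m)$ (the underlying set is $\mathbb{Z}$, not the integers modulo $m$). A prime $p$ is called a prime divisor of a sequence of integers if $p$ divides some term of the sequence. *)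

(* Defs.v *)
From HB Require Import structures.
From mathcomp Require Import all_boot all_order all_algebra.
From mathcomp Require Import all_classical topology.

Set Implicit Arguments.
Unset Strict Implicit.
Unset Printing Implicit Defensive.

Import Order.TTheory GRing.Theory Num.Theory.

Local Open Scope classical_set_scope.
Local Open Scope ring_scope.

Definition Con (a b : int) : set int := [set x | (x = a %[mod b])%Z].

Lemma Con_refl (a b : int) : Con a b a.
Proof. by []. Qed.

Lemma Con_sub (a b c t : int) : Con a b t -> Con t (b * c) `<=` Con a b.
Proof.
move=> abt x /eqP; rewrite eqz_mod_dvd => /(dvdz_trans (dvdz_mulr _ (dvdzz b))).
by rewrite -eqz_mod_dvd => /eqP xt; rewrite /Con /= xt.
Qed.

(* Indices (a, b) of the classes Con(a, b). *)
Definition con_index : Type := (int * int)%type.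

HB.instance Definition _ := Choice.copy con_index (int * int)%type.
HB.instance Definition _ := isPointed.Build con_index (0, 1).

(* Alias of [int], so that the Furstenberg topology does not clash with other
   topologies on [int]. *)
Definition furstenberg : Type := int.

HB.instance Definition _ := Choice.copy furstenberg int.

Section furstenberg_topology.

Let D : set con_index := [set i | 0 < i.2].
Let B (i : con_index) : set furstenberg := Con i.1 i.2.

Let B_cover : \bigcup_(i in D) B i = setT.
Proof. by apply/seteqP; split=> // x _; exists (x, 1) => //; exact: Con_refl. Qed.

Let B_join i j t : D i -> D j -> B i t -> B j t ->
  exists k, [/\ D k, B k t & B k `<=` B i `&` B j].
Proof.
move=> Di Dj Bi Bj; exists (t, i.2 * j.2); split; first exact: mulr_gt0.
  exact: Con_refl.
by rewrite subsetI; split; [|rewrite /B /= mulrC]; exact: Con_sub.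
Qed.

HB.instance Definition _ :=
  isBaseTopological.Build furstenberg B_cover B_join.

End furstenberg_topology.

(* The underlying set of [Zspace m] is the whole of [int]; [m] only selects the
   topology. *)
Definition Zspace (m : int) : Type := int.

HB.instance Definition _ (m : int) := Choice.copy (Zspace m) int.

Section Zspace_topology.
Variable m : int.

Let D : set con_index := [set i | 0 < i.2 /\ coprimez i.2 m].
Let B (i : con_index) : set (Zspace m) := Con i.1 i.2.

Let B_cover : \bigcup_(i in D) B i = setT.
Proof.
apply/seteqP; split=> // x _; exists (x, 1); last exact: Con_refl.
by split=> //=; rewrite /coprimez gcd1z.
Qed.

Let B_join i j t : D i -> D j -> B i t -> B j t ->
  exists k, [/\ D k, B k t & B k `<=` B i `&` B j].
Proof.
move=> [i0 im] [j0 jm] Bi Bj; exists (t, i.2 * j.2); split.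
- by split; [exact: mulr_gt0 | rewrite /= coprimezMl im].
- exact: Con_refl.
by rewrite subsetI; split; [|rewrite /B /= mulrC]; exact: Con_sub.
Qed.

HB.instance Definition _ :=
  isBaseTopological.Build (Zspace m) B_cover B_join.

End Zspace_topology.

Lemma open_furstenbergE (U : set furstenberg) :
  open U <-> forall x, U x -> exists b : int, 0 < b /\ Con x b `<=` U.
Proof.
split.
- move=> [D' D'D <-] x [i D'i Bx]; exists i.2; split; first exact: D'D.
  by move=> y xy; exists i => //; exact: etrans xy Bx.
- move=> H; exists [set i : con_index | 0 < i.2 /\ Con i.1 i.2 `<=` U].
    by move=> i [].
  apply/seteqP; split=> [x [i [_ iU] ix]|x /H[b [b0 bU]]]; first exact: iU.
  by exists (x, b) => //; exact: Con_refl.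
Qed.

Lemma open_ZspaceE (m : int) (U : set (Zspace m)) :
  open U <->
  forall x, U x -> exists b : int, [/\ 0 < b, coprimez b m & Con x b `<=` U].
Proof.
split.
- move=> [D' D'D <-] x [i D'i Bx]; have [i0 im] := D'D _ D'i.
  exists i.2; split=> //.
  by move=> y xy; exists i => //; exact: etrans xy Bx.
- move=> H; exists [set i : con_index |
      [/\ 0 < i.2, coprimez i.2 m & Con i.1 i.2 `<=` U]].
    by move=> i [].
  apply/seteqP; split=> [x [i [_ _ iU] ix]|x /H[b [b0 bm bU]]]; first exact: iU.
  by exists (x, b) => //; exact: Con_refl.
Qed.

(* As a type, [posint] carries the subspace topology (the instance on
   [set_type] in [subtype_topology]). *)
Definition posint : set furstenberg := [set n : int | 0 < n].

Definition unbounded (S : set int) : Prop :=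
  ~ exists M : int, forall x, S x -> `|x| <= M.

Definition prime_divisor (I : Type) (u : I -> int) (p : nat) : Prop :=
  prime p /\ exists i, (p %| u i)%Z.

(* Main.v *)
(* If only finitely many primes divide values of f, let P be their product and
   pick n0 with f(n0) <> 0. Since f(n0) P is prime to m, continuity gives
   f(n) = f(n0) (1 + P t) for n in a congruence class of n0. A prime factor of
   1 + P t divides f(n), hence P, which is absurd; so 1 + P t = 1 or -1 and |f|
   is constant on that class. *)
Require Import Defs.
From HB Require Import structures.
From mathcomp Require Import all_boot all_order all_algebra.
From mathcomp Require Import all_classical topology.

Import Order.TTheory GRing.Theory Num.Theory.

Local Open Scope classical_set_scope.
Local Open Scope ring_scope.

Lemma open_Con_Zspace (m a b : int) : 0 < b -> coprimez b m ->
  open (Con a b : set (Zspace m)).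
Proof.
move=> b0 bm; apply/open_ZspaceE => x ax; exists b; split=> // y xy.
exact: etrans xy ax.
Qed.

(** The preimage of the open class of [f n0] modulo [b] is the trace on [posint] of a
    Furstenberg-open [V], and [V] contains a whole class around [n0]. *)
Lemma continuous_posint_Zspace (m : int) (f : posint -> Zspace m)
    (n0 : posint) (b : int) : continuous f -> 0 < b -> coprimez b m ->
  exists2 c : int, 0 < c &
    forall n : posint, Con (set_val n0) c (set_val n) -> Con (f n0) b (f n).
Proof.
move=> /continuousP cf b0 bm.
have [V oV Vf] := cf _ (open_Con_Zspace m (f n0) b b0 bm).
have Vn n : V (set_val n) <-> Con (f n0) b (f n).
  by rewrite -[V _]/((set_val @^-1` V) n) Vf.
have /(_ (set_val n0)) := (open_furstenbergE V).1 oV.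
case=> [|c [c0 cV]]; first by apply/Vn; exact: Con_refl.
by exists c => // n /cV /Vn.
Qed.

Lemma unbounded_neq0 (S : set int) : unbounded S -> exists2 x, S x & x != 0.
Proof.
move=> uS; apply: contrapT => S0; apply: uS; exists 0 => x Sx.
by rewrite normr_le0; apply/negPn/negP => x0; apply: S0; exists x.
Qed.

Lemma absz_eq1_noprime (z : int) :
  (forall p : nat, prime p -> ~~ (p %| z)%Z) -> `|z|%N = 1%N.
Proof.
move=> zp; case: (ltngtP `|z|%N 1%N) => // [|z1].
  (* The case [z = 0] is excluded because 2 divides 0. *)
  by rewrite ltnS leqn0 => z0; have := zp 2 isT; rewrite dvdzE (eqP z0).
by have := zp _ (pdiv_prime z1); rewrite dvdzE /= pdiv_dvd.
Qed.

Theorem theorem2p3 (m : int) (f : posint -> Zspace m) :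
  m != 0 ->
  continuous f ->
  (forall a b : int, 0 < b ->
     unbounded [set f n | n in [set n : posint | Con a b (set_val n)]]) ->
  (forall n : posint, coprimez (f n) m) ->
  infinite_set [set p : nat | prime_divisor f p].
Proof.
move=> _ cf uf fm /finite_seqP[s sE].
have sP p : prime_divisor f p <-> p \in s.
  by rewrite -[prime_divisor f p]/([set p | prime_divisor f p] p) sE.
(* The class of 0 modulo 1 contains every index. *)
have [_ [n0 _ <-] fn0] := unbounded_neq0 _ (uf 0 1 ltr01).
pose P : int := \prod_(p <- s) p%:Z.
(* Each prime in [s] divides some value of [f], and that value is prime to [m]. *)
have Pm : coprimez P m.
  rewrite /P big_seq; elim/big_ind: _ => [|x y xm ym|p /sP[pp [i pfi]]].
  - by rewrite /coprimez gcd1z.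
  - by rewrite coprimezMl xm.
  - exact: coprimez_dvdl pfi (fm i).
have P_gt0 : 0 < P.
  rewrite /P big_seq; apply: prodr_gt0 => p /sP[pp _].
  by rewrite ltz_nat prime_gt0.
(* The absolute value makes the modulus positive; [f n0] may be negative. *)
pose b : int := `|f n0 : int| * P.
have b_gt0 : 0 < b by rewrite mulr_gt0// normr_gt0.
have bm : coprimez b m.
  by rewrite coprimezMl Pm andbT; have := fm n0; rewrite !coprimezE absz_id.
have [c c0 cP] := continuous_posint_Zspace m f n0 b cf b_gt0 bm.
(* Unboundedness on the class of [n0] modulo [c] is contradicted by the bound [|f n0|]. *)
apply: (uf (set_val n0) c c0); exists `|f n0 : int| => _ [n /cP nb <-].
have /dvdzP[t tE] : (f n0 * P %| (f n : int) - f n0)%Z.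
  have : (b %| (f n : int) - f n0)%Z by rewrite -eqz_mod_dvd; apply/eqP.
  by rewrite !dvdzE !abszM absz_id.
have fE : (f n : int) = f n0 * (1 + P * t).
  by rewrite mulrDr mulr1 mulrA [_ * t]mulrC -tE addrC subrK.
suff t1 : `|(1 + P * t)%R|%N = 1%N by rewrite fE normrM -[X in _ * X]abszE t1 mulr1.
apply: absz_eq1_noprime => p pp; apply/negP => pt.
have /sP ps : prime_divisor f p.
  by split=> //; exists n; rewrite fE dvdz_mull.
have pP : (p %| P * t)%Z by rewrite dvdz_mulr// /P (big_rem _ ps) dvdz_mulr.
(* Dividing both [1 + P * t] and [P * t], the prime [p] would divide 1. *)
by move: pt; rewrite rpredDr// dvdzE dvdn1 => /eqP p1; rewrite [p]p1 in pp.
Qed.
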